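(* Let $n, m \geq 1$, and for each $j = 1,\dots,m$ let $Q_j \in \mathbb{R}^{n\times n}$ be a symmetric positive definite matrix and $x_j^f \in \mathbb{R}^n$. Then the set of global optima $$\mathcal{G} = \Big\{x \in \mathbb{R}^n \;\Big|\; \exists \alpha \in \Delta^m : \Big(\sum_{j=1}^m \alpha_j Q_j\Big) x = \sum_{j=1}^m \alpha_j Q_j x_j^f\Big\}$$ is path-connected.
   Context: $\Delta^m = \{\alpha \in \mathbb{R}^m \mid \alpha_i \geq 0 \text{ for all } i,\ \sum_{i=1}^m \alpha_i = 1\}$ is the probability simplex. The set $\mathcal{G}$ is the set of points $x$ that minimize over $\mathbb{R}^n$ some convex combination $f_\alpha = \sum_{j=1}^m \alpha_j f_j$, $\alpha \in \Delta^m$, of the strictly convex quadratics $f_j(x) = \tfrac12 (x - x_j^f)^T Q_j (x - x_j^f)$. A set $X$ is path-connected if for every two points $x^0, x^1 \in X$ there is a continuous curve $\omega : [0,1] \to X$ with $\omega(0) = x^0$ and $\omega(1) = x^1$. *)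

(* Defs.v *)
From mathcomp Require Import all_boot all_order all_algebra.
From mathcomp Require Import all_classical all_reals all_analysis.

Set Implicit Arguments.
Unset Strict Implicit.
Unset Printing Implicit Defensive.

Import Order.TTheory GRing.Theory Num.Theory.
Import numFieldNormedType.Exports.

Local Open Scope classical_set_scope.
Local Open Scope ring_scope.

Definition posdefmx (R : realType) (n : nat) (A : 'M[R]_n) : Prop :=
  forall x : 'cV[R]_n, x != 0 -> 0 < (x^T *m A *m x) 0 0.

Definition simplex (R : realType) (m : nat) : set 'cV[R]_m :=
  [set alpha | (forall j, 0 <= alpha j 0) /\ \sum_(j < m) alpha j 0 = 1].

(* The linear system is the stationarity condition of
   \sum_j alpha_j f_j, where f_j(x) = 1/2 (x - xf j)^T (Q j) (x - xf j). *)
Definition global_optima (R : realType) (n m : nat)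
    (Q : 'I_m -> 'M[R]_n) (xf : 'I_m -> 'cV[R]_n) : set 'cV[R]_n :=
  [set x | exists2 alpha, simplex alpha &
    (\sum_(j < m) alpha j 0 *: Q j) *m x =
      \sum_(j < m) alpha j 0 *: (Q j *m xf j)].

(* Curves are total functions on R; only their restriction to [0, 1] matters. *)
Definition path_connected (R : realType) (T : topologicalType) (X : set T) :
    Prop :=
  forall x0 x1, X x0 -> X x1 -> exists omega : R -> T,
    [/\ {within `[0, 1], continuous omega},
        forall t, t \in `[0, 1] -> X (omega t),
        omega 0 = x0 & omega 1 = x1].
Arguments path_connected R {T} X.

(* Main.v *)
(** Each weighted matrix [\sum_j alpha_j Q_j] with [alpha] in the simplex is
    positive definite, hence invertible, so a point of the set of global optima
    is determined by its weights.  Join the weights of the two endpoints by a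
    segment: the solution of the linear system along it is given by Cramer's
    rule, i.e. by polynomials in [t] divided by a determinant that is a
    polynomial in [t] without zeros on [0, 1], and so depends continuously
    on [t]. *)

Require Import Defs.
From mathcomp Require Import all_boot all_order all_algebra.
From mathcomp Require Import all_classical all_reals all_analysis.
Import Order.TTheory GRing.Theory Num.Theory.
Import numFieldNormedType.Exports.

Set Implicit Arguments.
Unset Strict Implicit.
Unset Printing Implicit Defensive.

Local Open Scope classical_set_scope.
Local Open Scope ring_scope.

(** If the determinant vanished, some nonzero row [v] would satisfy [v *m A = 0], and the quadratic
    form would be zero at [v^T]. *)
Lemma posdefmx_det_neq0 (R : realType) (n : nat) (A : 'M[R]_n) :
  posdefmx A -> \det A != 0.
Proof.
move=> Apos; apply/negP => /det0P[v v0 vA].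
have := Apos v^T; rewrite trmxK vA mul0mx mxE ltxx.
by rewrite -trmx0 (inj_eq trmx_inj) => /(_ v0).
Qed.

Lemma posdefmx_simplex (R : realType) (n m : nat) (Q : 'I_m -> 'M[R]_n)
    (alpha : 'cV[R]_m) :
  (forall j, posdefmx (Q j)) -> simplex alpha ->
  posdefmx (\sum_(j < m) alpha j 0 *: Q j).
Proof.
move=> Qpos [alpha_ge0 alpha1] x x0.
have -> : (x^T *m (\sum_(j < m) alpha j 0 *: Q j) *m x) 0 0 =
    \sum_(j < m) alpha j 0 * (x^T *m Q j *m x) 0 0.
  rewrite mulmx_sumr mulmx_suml summxE; apply: eq_bigr => j _.
  by rewrite -scalemxAr -scalemxAl mxE.
have term_ge0 j : 0 <= alpha j 0 * (x^T *m Q j *m x) 0 0.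
  by rewrite mulr_ge0 // ltW // Qpos.
(* If this sum of nonnegative terms were zero, each term would vanish. The quadratic forms being
   positive at [x], all weights would be zero, against their sum being 1. *)
rewrite lt0r sumr_ge0 // andbT; apply/negP => /eqP sum0.
suff alpha0 : \sum_(j < m) alpha j 0 = 0.
  by move: alpha1; rewrite alpha0 => /eqP; rewrite eq_sym oner_eq0.
apply: big1 => j _; apply/eqP.
have /(_ j isT)/eqP := psumr_eq0P (fun j _ => term_ge0 j) sum0.
by rewrite mulf_eq0 (gt_eqF (Qpos j x x0)) orbF.
Qed.

Lemma simplex_segment (R : realType) (m : nat) (a b : 'cV[R]_m) (t : R) :
  simplex a -> simplex b -> 0 <= t <= 1 -> simplex (a + t *: (b - a)).
Proof.
move=> [a0 a1] [b0 b1] /andP[t0 t1]; split => [j|].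
  rewrite !mxE (_ : _ + _ = (1 - t) * a j 0 + t * b j 0); last first.
    by rewrite mulrBr mulrBl mul1r addrCA addrC.
  by rewrite addr_ge0 // mulr_ge0 // subr_ge0.
under eq_bigr do rewrite !mxE.
by rewrite big_split/= -mulr_sumr sumrB a1 b1 subrr mulr0 addr0.
Qed.

(** A neighbourhood of [L] contains a product of entrywise neighbourhoods, and a filter is closed
    under the finite intersection over all index pairs. *)
Lemma cvg_mx_coord (T : Type) (U : topologicalType) (m n : nat)
    (F : set_system T) (FF : Filter F) (f : T -> 'M[U]_(m, n))
    (L : 'M[U]_(m, n)) :
  (forall i j, f x i j @[x --> F] --> L i j) -> f x @[x --> F] --> L.
Proof.
move=> fL A [P LP PA].
suff : \forall x \near F, forall ij : 'I_m * 'I_n, P ij.1 ij.2 (f x ij.1 ij.2).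
  by apply: filterS => x Px; apply: PA => i j; exact: (Px (i, j)).
by apply: filter_forall => -[i j]; exact/fL/LP.
Qed.

(** Determinant and adjugate are taken over the polynomial ring and evaluated only afterwards, so
    that continuity reduces to that of polynomials. *)
Definition cramer_curve (R : realType) (n : nat) (P : 'M[{poly R}]_n)
    (b : 'cV[{poly R}]_n) (t : R) : 'cV[R]_n :=
  (\det P).[t]^-1 *: map_mx (horner_eval t) (\adj P *m b).

Section CramerCurve.
Context (R : realType) (n : nat) (P : 'M[{poly R}]_n) (b : 'cV[{poly R}]_n).
Context (t : R) (det_neq0 : (\det P).[t] != 0).

Lemma cramer_curve_solution :
  map_mx (horner_eval t) P *m cramer_curve P b t = map_mx (horner_eval t) b.
Proof.
rewrite /cramer_curve -scalemxAr -map_mxM mulmxA mul_mx_adj mul_scalar_mx.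
by rewrite map_mxZ scalerA mulVf // scale1r.
Qed.

(** Multiplying the system by the adjugate on the left isolates [x]. This is what makes the curve
    start and end at the prescribed points. *)
Lemma cramer_curve_unique (x : 'cV[R]_n) :
  map_mx (horner_eval t) P *m x = map_mx (horner_eval t) b ->
  cramer_curve P b t = x.
Proof.
move=> Px; rewrite /cramer_curve map_mxM -Px mulmxA -map_mxM mul_adj_mx.
by rewrite map_scalar_mx mul_scalar_mx scalerA mulVf // scale1r.
Qed.

Lemma continuous_cramer_curve : {for t, continuous (cramer_curve P b)}.
Proof.
apply: cvgZ; first by apply: cvgV => //; exact: continuous_horner.
apply: cvg_mx_coord => i j; rewrite mxE.
under eq_fun do rewrite mxE.
exact: continuous_horner.
Qed.

End CramerCurve.

Lemma horner_weighted_sum (R : realType) (n p m : nat) (a : 'I_m -> {poly R})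
    (B : 'I_m -> 'M[R]_(n, p)) (t : R) :
  map_mx (horner_eval t) (\sum_(j < m) a j *: map_mx polyC (B j)) =
    \sum_(j < m) (a j).[t] *: B j.
Proof.
apply/matrixP => i k; rewrite mxE !summxE horner_evalE horner_sum.
by apply: eq_bigr => j _; rewrite !mxE hornerM hornerC.
Qed.

Theorem mainTheorem3 (R : realType) (n m : nat)
    (n_ge1 : (1 <= n)%N) (m_ge1 : (1 <= m)%N)
    (Q : 'I_m -> 'M[R]_n) (xf : 'I_m -> 'cV[R]_n)
    (Qsym : forall j, Q j \is symmetricmx)
    (Qpos : forall j, posdefmx (Q j)) :
  path_connected R (global_optima Q xf).
Proof.
move=> x0 x1 [a0 a0S a0x] [a1 a1S a1x].
(* The weights along the segment, as polynomials of degree at most 1; [alpha] gives their values. *)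
pose a j : {poly R} := (a0 j 0)%:P + (a1 j 0 - a0 j 0) *: 'X.
pose alpha t := a0 + t *: (a1 - a0).
pose P := \sum_(j < m) a j *: map_mx polyC (Q j).
pose b := \sum_(j < m) a j *: map_mx polyC (Q j *m xf j).
have aE t j : (a j).[t] = alpha t j 0.
  by rewrite !hornerE !mxE mulrC.
have PE t : map_mx (horner_eval t) P = \sum_(j < m) alpha t j 0 *: Q j.
  by rewrite horner_weighted_sum; under eq_bigr do rewrite aE.
have bE t : map_mx (horner_eval t) b =
    \sum_(j < m) alpha t j 0 *: (Q j *m xf j).
  by rewrite horner_weighted_sum; under eq_bigr do rewrite aE.
have alphaS t : t \in `[0, 1] -> simplex (alpha t).
  by rewrite in_itv/=; exact: simplex_segment.
have det_neq0 t : t \in `[0, 1] -> (\det P).[t] != 0.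
  move=> /alphaS tS; rewrite -horner_evalE -det_map_mx PE.
  exact/posdefmx_det_neq0/posdefmx_simplex.
have alpha0 : alpha 0 = a0 by rewrite /alpha scale0r addr0.
have alpha1 : alpha 1 = a1 by rewrite /alpha scale1r addrC subrK.
exists (cramer_curve P b); split.
(* The curve is continuous as a function on all of [R] at each point of the interval, which is
   stronger than continuity within it. *)
- apply: continuous_in_subspaceT => t; rewrite mem_setE => /det_neq0.
  exact: continuous_cramer_curve.
- move=> t t01; exists (alpha t); first exact: alphaS.
  by rewrite -PE -bE cramer_curve_solution // det_neq0.
- apply: cramer_curve_unique; last by rewrite PE bE alpha0.
  by apply: det_neq0; rewrite in_itv/= lexx ler01.
- apply: cramer_curve_unique; last by rewrite PE bE alpha1.
  by apply: det_neq0; rewrite in_itv/= ler01 lexx.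
Qed.
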